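(* Let $\Sigma=(G,\sigma)$ be a signed graph with $m$ edges and let $k$ be a positive integer with $$k>\binom{m}{3}+\binom{m}{4}+m-1 .$$ Then $P_l(\Sigma,k)=P(\Sigma,k)$. Further, every $k$-assignment $L$ of $\Sigma$ with $P(\Sigma,L)=P(\Sigma,k)$ satisfies $L(u)=\sigma(e)L(v)$ for each edge $e=uv$ of $\Sigma$. In particular, if $\Sigma$ is unbalanced, then such an $L$ satisfies $L(v)=-L(v)=\{-a:a\in L(v)\}$ for each vertex $v$ in any unbalanced component of $\Sigma$.
   Context: A signed graph $\Sigma=(G,\sigma)$ is a finite graph $G$ with a sign function $\sigma:E(G)\to\{-1,1\}$; an edge $e$ is negative if $\sigma(e)=-1$ and positive otherwise. A cycle is unbalanced if it has an odd number of negative edges and balanced otherwise; a signed graph (or a component) is unbalanced if it contains an unbalanced cycle and balanced otherwise. For a positive integer $k$, let $M_k=\{0,\pm1,\ldots,\pm t\}$ if $k=2t+1$ and $M_k=\{\pm1,\ldots,\pm t\}$ if $k=2t$. A proper $k$-coloring of $\Sigma$ is a map $c:V(\Sigma)\to M_k$ with $c(u)\neq\sigma(e)c(v)$ for every edge $e=uv$; $P(\Sigma,k)$ denotes the number of proper $k$-colorings. A list-assignment $L$ assigns to each vertex $v$ a nonempty set $L(v)\subseteq\mathbb{Z}$; it is a $k$-assignment if $|L(v)|=k$ for all $v$. An $L$-coloring is a map $c$ with $c(v)\in L(v)$ for all $v$ and $c(u)\neq\sigma(e)c(v)$ for every edge $e=uv$; $P(\Sigma,L)$ is the number of $L$-colorings.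 For a set $S\subseteq\mathbb{Z}$ and $s\in\{\pm1\}$, $sS=\{sa:a\in S\}$. The list-coloring function is $P_l(\Sigma,k)=\min\{P(\Sigma,L): L \text{ a } k\text{-assignment of }\Sigma\}$. *)

(* Defs.v *)
From HB Require Import structures.
From mathcomp Require Import all_boot all_order all_algebra.
From mathcomp Require Import finmap.
From mathcomp Require boolp.

Set Implicit Arguments.
Unset Strict Implicit.
Unset Printing Implicit Defensive.

Import Order.TTheory GRing.Theory Num.Theory.

Local Open Scope fset_scope.
Local Open Scope ring_scope.

(* Edges are unordered pairs of distinct vertices, so the underlying graph is
   simple.  Only the values of [sigma] on [edges] matter. *)
Record signed_graph := SignedGraph {
  vertex :> finType;
  edges : {set {set vertex}};
  edges_card2 : forall e, e \in edges -> #|e| = 2%N;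
  sigma : {set vertex} -> int;
  sigma_pm1 : forall e, e \in edges -> sigma e = 1 \/ sigma e = -1
}.

Section SignedGraph.
Variable Sg : signed_graph.

Definition adj : rel Sg := fun u v => [set u; v]%SET \in edges Sg.

Definition is_cycle (p : seq Sg) : bool := (2 < size p)%N && ucycleb adj p.

Definition cycle_edges (p : seq Sg) : {set {set Sg}} :=
  [set [set x; next p x] | x in p]%SET.

Definition unbalanced_cycle (p : seq Sg) : bool :=
  is_cycle p && odd #|[set e in cycle_edges p | sigma e == -1]%SET|.

Definition component (C : {set Sg}) : Prop :=
  exists v : Sg, C = [set u | connect adj v u]%SET.

Definition unbalanced_component (C : {set Sg}) : Prop :=
  component C /\ exists p : seq Sg, unbalanced_cycle p /\ {subset p <= C}.

Definition unbalanced : Prop := exists p : seq Sg, unbalanced_cycle p.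

Definition proper (c : Sg -> int) : bool :=
  [forall u, forall v, adj u v ==> (c u != sigma [set u; v]%SET * c v)].

Definition list_assignment := Sg -> {fset int}.

Definition k_assignment (k : nat) (L : list_assignment) : Prop :=
  forall v, #|` L v| = k.

Definition num_list_colorings (L : list_assignment) : nat :=
  #|[set c : {dffun forall v : Sg, L v} | proper (fun v => val (c v))]%SET|.

End SignedGraph.

Definition pos_colors (t : nat) : {fset int} := [fset i%:Z | i in iota 1 t].

Definition scale_set (s : int) (A : {fset int}) : {fset int} :=
  [fset s * a | a in A].

Definition M (k : nat) : {fset int} :=
  (if odd k then [fset 0] else fset0)
    `|` (pos_colors k./2 `|` scale_set (-1) (pos_colors k./2)).

Lemma mem_pos_colors t (a : int) : (a \in pos_colors t) = (0 < a <= t%:Z).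
Proof.
apply/imfsetP/idP => [[i /=]|].
  by rewrite mem_iota add1n ltnS => /andP[i0 it] ->; rewrite ltz_nat lez_nat i0.
case: a => [n|n]; last by [].
by rewrite ltz_nat lez_nat => nt; exists n => //=; rewrite mem_iota add1n ltnS.
Qed.

Lemma mem_scale_setN A (a : int) : (a \in scale_set (-1) A) = (- a \in A).
Proof.
apply/imfsetP/idP => [[b bA ->]|aA]; first by rewrite mulN1r opprK.
by exists (- a) => //; rewrite mulN1r opprK.
Qed.

Lemma card_scale_setN A : #|` scale_set (-1) A| = #|` A|.
Proof. by rewrite card_imfset //= => a b; rewrite !mulN1r => /oppr_inj. Qed.

Lemma card_pos_colors t : #|` pos_colors t| = t.
Proof.
rewrite card_imfset /=; last by move=> i j [].
by rewrite undup_id ?iota_uniq ?size_iota.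
Qed.

Lemma card_M k : #|` M k| = k.
Proof.
have disj A B : (forall a : int, a \in A -> a \in B -> False) ->
    #|` A `|` B| = (#|` A| + #|` B|)%N.
  move=> AB; apply/eqP; rewrite eq_sym -(eqn_add2r #|` A `&` B|).
  rewrite cardfsUI; suff -> : A `&` B = fset0 by rewrite cardfs0 addn0.
  by apply/fsetP => a; rewrite inE in_fset0; apply/negP => /andP[/AB].
rewrite /M disj; last first.
  move=> a; case: ifP => _; last by rewrite in_fset0.
  rewrite in_fset1 => /eqP ->.
  by rewrite in_fsetU mem_scale_setN oppr0 mem_pos_colors ltxx.
rewrite disj; last first.
  move=> a; rewrite mem_scale_setN !mem_pos_colors => /andP[a0 _] /andP[].
  by rewrite oppr_gt0 ltNge (ltW a0).
rewrite card_scale_setN card_pos_colors -[in RHS](odd_double_half k) -addnn.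
by case: ifP => _; rewrite ?cardfs1 ?cardfs0.
Qed.

Definition num_colorings (Sg : signed_graph) (k : nat) : nat :=
  #|[set c : {ffun Sg -> M k} | proper (fun v => val (c v))]%SET|.

Definition list_coloring_value (Sg : signed_graph) (k n : nat) : Prop :=
  exists L : list_assignment Sg, k_assignment k L /\ num_list_colorings L = n.

Lemma list_coloring_value_ex (Sg : signed_graph) (k : nat) :
  exists n, boolp.asbool (list_coloring_value Sg k n).
Proof.
exists (num_list_colorings (fun _ : Sg => M k)); apply/boolp.asboolP.
by exists (fun=> M k); split=> // v; apply: card_M.
Qed.

Definition list_coloring_function (Sg : signed_graph) (k : nat) : nat :=
  ex_minn (list_coloring_value_ex Sg k).

(* Main.v *)
(** Order the edges.  An edge [e = uv] is bad for a coloring [c] when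
    [c u = sigma e * c v], a linear equation on [c].  For a nonempty set of bad
    edges, toggling its smallest element is a sign-reversing involution on the
    subsets without broken circuit, so
      [P(L) = sum over nbc sets A of (-1)^|A| N(A, L)],
    where [N(A, L)] counts the [L]-maps for which all edges of [A] are bad.  The
    equations of an nbc set are linearly independent, whence
    [N(A, L) <= k^(n - |A|)].  Write [d e = k - |L u inter sigma e (L v)|] and
    let [D] be the sum of all [d e].  Comparing [L] with the constant assignment
    [M k], the sets [A] with one edge contribute [D k^(n-2)] to [P(L) - P(k)],
    those with two edges at least [- (m-1) D k^(n-3)], and the larger ones at
    least [- (C(m,3) + C(m,4)) k^(n-3)].  So [P(L) > P(k)] as soon as [D > 0].
    If [D = 0], the lists in a component are all equal up to sign to the list of
    a root [r], and an injection [M k -> L r] that is odd when [L r] is symmetric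
    turns proper [k]-colorings into [L]-colorings injectively. *)

Require Import Defs.
From HB Require Import structures.
From mathcomp Require Import all_boot all_order all_algebra.
From mathcomp Require Import finmap.
From mathcomp Require Import boolp zify ring lra.

Set Implicit Arguments.
Unset Strict Implicit.
Unset Printing Implicit Defensive.

Import Order.TTheory GRing.Theory Num.Theory.
Local Open Scope ring_scope.

(** * Broken circuits *)

Section EdgeEquations.
Variable Sg : signed_graph.
Implicit Types (e x y : {set Sg}) (A B : {set {set Sg}}).

(** Quantifying over both orders of the endpoints avoids orienting [e]. The ring varies because
    colorings are integral while the linear algebra runs over [rat]. *)
Definition sat (R : pzRingType) (c : Sg -> R) e : bool :=
  [forall u, forall v, (e == [set u; v]%SET) ==> (c u == (sigma e)%:~R * c v)].

Lemma edge_endpoints e : e \in edges Sg ->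
  exists u v, u != v /\ e = [set u; v]%SET.
Proof. by move=> /edges_card2 /eqP /cards2P. Qed.

Lemma sigma_sqr (R : pzRingType) e (a b : R) : e \in edges Sg ->
  a = (sigma e)%:~R * b -> b = (sigma e)%:~R * a.
Proof.
move=> /sigma_pm1 [] -> ->; first by rewrite !mul1r.
by rewrite !mulN1r opprK.
Qed.

Lemma sat_edge (R : pzRingType) (c : Sg -> R) u v :
  [set u; v]%SET \in edges Sg ->
  sat c [set u; v] = (c u == (sigma [set u; v]%SET)%:~R * c v).
Proof.
move=> uvE; apply/forallP/idP => [/(_ u) /forallP /(_ v)|/eqP cuv u'].
  by rewrite eqxx.
apply/forallP => v'; apply/implyP => /eqP uv'.
have uv : u != v by move: (edges_card2 uvE); rewrite cards2; case: (u != v).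
have u'in : u' \in [set u; v]%SET by rewrite uv' set21.
have v'in : v' \in [set u; v]%SET by rewrite uv' set22.
have u'v' : u' != v'.
  by move: (edges_card2 uvE); rewrite uv' cards2; case: (u' != v').
move: u'in v'in u'v'; rewrite !inE => /orP[] /eqP-> /orP[] /eqP->;
  rewrite ?eqxx // => _; first exact/eqP.
by apply/eqP/sigma_sqr.
Qed.

Lemma sat_endpoints (R : pzRingType) (c : Sg -> R) e : e \in edges Sg ->
  forall u v, e = [set u; v]%SET -> sat c e = (c u == (sigma e)%:~R * c v).
Proof. by move=> eE u v euv; rewrite euv sat_edge // -euv. Qed.

Lemma sat_indicator (e : {set Sg}) u : e \in edges Sg ->
  sat (fun w => (w == u)%:R : rat) e = (u \notin e).
Proof.
move=> eE; have [a [b [ab eab]]] := edge_endpoints eE.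
rewrite (sat_endpoints _ eE eab) [in RHS]eab !inE.
have [->|ua] := eqVneq u a.
  by rewrite [b == a]eq_sym (negPf ab) mulr0 oner_eq0.
have [_|_] := eqVneq u b => /=.
  by case: (sigma_pm1 eE) => ->; rewrite mulr1.
by rewrite mulr0 eqxx.
Qed.

Lemma sat_ratr (c : Sg -> int) e :
  sat (fun v => (c v)%:~R : rat) e = sat c e.
Proof.
apply: eq_forallb => u; apply: eq_forallb => v; congr (_ ==> _).
by rewrite -intrM eqr_int intz.
Qed.

Lemma properE (c : Sg -> int) :
  Defs.proper c = [forall e, (e \in edges Sg) ==> ~~ sat c e].
Proof.
apply/forallP/forallP => [cP e|cP u].
  apply/implyP => eE; have [u [v [uv euv]]] := edge_endpoints eE.
  rewrite (sat_endpoints _ eE euv); move/forallP/(_ v): (cP u).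
  by rewrite /adj -euv eE intz.
apply/forallP => v; apply/implyP => uvE; move: (cP [set u; v]%SET).
by rewrite (uvE : _ \in edges Sg) /= sat_edge // intz.
Qed.

Lemma sat_lincomb (I : finType) (z : I -> Sg -> rat) (a : I -> rat) e
    (P : pred I) : (forall i, P i -> sat (z i) e) ->
  sat (fun v => \sum_(i | P i) a i * z i v) e.
Proof.
move=> zP; apply/forallP => u; apply/forallP => v; apply/implyP => euv.
apply/eqP; rewrite mulr_sumr; apply: eq_bigr => i /zP.
move=> /forallP/(_ u)/forallP/(_ v); rewrite euv /= => /eqP ->.
by rewrite mulrCA.
Qed.

(* [A] contains no broken circuit of the matroid of edge equations: the
   larger edges of [A] never imply the equation of an edge [x]. *)
Definition nbc A : bool := `[< forall x, x \in edges Sg ->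
  ~ (forall z : Sg -> rat,
      (forall y, y \in A -> (enum_rank x < enum_rank y)%N -> sat z y) ->
      sat z x) >].

Lemma nbcS A B : A \subset B -> nbc B -> nbc A.
Proof.
move=> sAB /asboolP nB; apply/asboolP => x xE xA; apply: (nB x xE) => z zB.
by apply: xA => y yA; apply: zB; apply: (subsetP sAB).
Qed.

(** If [x] differs from [e], some endpoint of [x] lies off [e], and its indicator solves [e] but not
    [x]; if [x = e], no larger edge is available. *)
Lemma nbc_set1 (e : {set Sg}) : e \in edges Sg -> nbc [set e].
Proof.
move=> eE; apply/asboolP => x xE xe.
have [u ux ue] : exists2 u, u \in x & (x == e) || (u \notin e).
  have [->|xNe] := eqVneq x e.
    by have [a [b [_ ->]]] := edge_endpoints eE; exists a; rewrite ?set21.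
  have /subsetPn [u ux ue] : ~~ (x \subset e).
    apply: contra xNe => xe'.
    by rewrite eqEcard xe' (edges_card2 xE) (edges_card2 eE).
  by exists u.
have := xe (fun w => (w == u)%:R); rewrite sat_indicator // ux => h.
have // : false; apply: h => y; rewrite inE => /eqP -> xe'.
by rewrite sat_indicator //; case/orP: ue xe' => // /eqP ->; rewrite ltnn.
Qed.

(** An [x] before [b] that is implied by edges of [b |: A] would lie in the closed set [B], against
    the minimality of [b]. For any other [x], [b] is not among the edges after [x] and adds
    nothing. *)
Lemma nbc_toggle B b A : B \subset edges Sg -> b \in B ->
  (forall x, x \in edges Sg ->
    (forall z : Sg -> rat, (forall y, y \in B -> sat z y) -> sat z x) ->
    x \in B) ->
  (forall x, x \in B -> (enum_rank b <= enum_rank x)%N) ->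
  A \subset B -> nbc A -> nbc (b |: A).
Proof.
move=> sBE bB clB minb sAB /asboolP nA; apply/asboolP => x xE xbA.
have [xb|bx] := ltnP (enum_rank x) (enum_rank b).
  have /minb : x \in B; last by rewrite leqNgt xb.
  apply: clB => // z zB; apply: xbA => y.
  by rewrite !inE => /orP[/eqP->|/(subsetP sAB)] *; apply: zB.
apply: (nA x xE) => z zA; apply: xbA => y.
rewrite !inE => /orP[/eqP->|yA]; last exact: zA.
by rewrite ltnNge bx.
Qed.

Definition bad (c : Sg -> int) : {set {set Sg}} :=
  [set e in edges Sg | sat c e]%SET.

Lemma bad_closed (c : Sg -> int) x : x \in edges Sg ->
  (forall z : Sg -> rat, (forall y, y \in bad c -> sat z y) -> sat z x) ->
  x \in bad c.
Proof.
move=> xE; move=> /(_ (fun v => (c v)%:~R)); rewrite inE xE sat_ratr; apply.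
by move=> y; rewrite inE sat_ratr => /andP[].
Qed.

Lemma sum_nbc_bad (c : Sg -> int) :
  \sum_(A : {set {set Sg}} | (A \subset bad c) && nbc A) (-1) ^+ #|A|
  = (Defs.proper c)%:R :> rat.
Proof.
have sBE : bad c \subset edges Sg by apply/subsetP => e; rewrite inE => /andP[].
have -> : Defs.proper c = (bad c == set0)%SET.
  rewrite properE; apply/forallP/eqP => [cP|/setP c0 e].
    apply/setP => e; move: (cP e); rewrite !inE.
    by case: (e \in _) => //= /negPf.
  by apply/implyP => eE; move: (c0 e); rewrite !inE eE /= => ->.
(* Without bad edges only the empty set contributes; it is [nbc] because no edge equation holds
   identically. *)
have [c0|[b0 b0B]] := set_0Vmem (bad c).
  rewrite c0 eqxx (big_pred1 set0) ?cards0 // => A.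
  rewrite subset0 andb_idr // => /eqP ->; apply/asboolP => x xE x0.
  have [u [v [_ xuv]]] := edge_endpoints xE.
  have := x0 (fun w => (w == u)%:R); rewrite sat_indicator // xuv set21 => zx.
  by have : false by apply: zx => y; rewrite inE.
have /negPf -> : (bad c != set0)%SET by apply/set0Pn; exists b0.
pose b := [arg min_(x < b0 | x \in bad c) enum_rank x : nat].
have [bB minb] : b \in bad c /\
    (forall x, x \in bad c -> (enum_rank b <= enum_rank x)%N).
  by rewrite /b; case: arg_minnP.
pose h A := (if b \in A then A :\ b else b |: A)%SET.
have hK : involutive h.
  move=> A; rewrite /h; case: (boolP (b \in A)) => bA.
    by rewrite setD11 setD1K.
  by rewrite setU11 setU1K.
pose P A := (A \subset bad c) && nbc A.
have hP1 A : P A -> P (h A).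
  rewrite /P /h => /andP[sA nA]; case: ifP => bA.
    by rewrite (subset_trans (subD1set A b)) // (nbcS _ nA) // subD1set.
  rewrite subUset sub1set bB sA /=.
  by apply: (nbc_toggle sBE bB) => // x; apply: bad_closed.
have hP A : P (h A) = P A by apply/idP/idP => /hP1; rewrite ?hK.
have hs A : (-1) ^+ #|h A| = - (-1) ^+ #|A| :> rat.
  rewrite /h; case: ifP => bA; last by rewrite cardsU1 bA exprS mulN1r.
  by rewrite [in RHS](cardsD1 b) bA exprS mulN1r opprK.
set S := LHS; have : S = - S; last first.
  by move=> /eqP; rewrite -addr_eq0 -mulr2n mulrn_eq0 => /eqP.
rewrite {1}/S (reindex_inj (inv_inj hK)) /S -sumrN.
by apply: eq_big => A; [rewrite -/(P _) hP|rewrite hs].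
Qed.

(** The solution space of [A] embeds in the coordinates [F]: a way to bound its dimension by [#|F|]
    without matrices. *)
Definition determines (F : {set Sg}) A : Prop :=
  forall z : Sg -> rat, (forall y, y \in A -> sat z y) ->
    (forall v, v \in F -> z v = 0) -> forall v, z v = 0.

(* Otherwise, for every [f] in [F] some nonzero solution of [a |: A] vanishes on
   [F :\ f]; these solutions span those of [A], so [a] would follow from [A]. *)
Lemma determines_exchange F A a (z0 : Sg -> rat) :
  determines F A -> (forall y, y \in A -> sat z0 y) -> ~~ sat z0 a ->
  exists2 f, f \in F & determines (F :\ f) (a |: A).
Proof.
move=> dF z0A z0a; apply: contrapT => noF.
(* [f \in F] stands under the existential so that [fin_all_exists] chooses for all [f] at once; off
   [F] any value serves. *)
have zf f : exists z : Sg -> rat, f \in F ->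
    [/\ forall y, y \in a |: A -> sat z y, forall v, v \in F :\ f -> z v = 0
       & z f = 1].
  have [fF|fF] := boolP (f \in F); last by exists (fun=> 0).
  apply: contrapT => noz; apply: noF; exists f => // z zA zF.
  have zf0 : z f = 0.
    apply/eqP/negPn/negP => zfN0; apply: noz; exists (fun v => (z f)^-1 * z v).
    move=> _; split; last by rewrite mulVf.
      move=> y /zA zy.
      have := @sat_lincomb unit (fun _ => z) (fun _ => (z f)^-1) y xpredT.
      move=> /(_ (fun _ _ => zy)); congr is_true.
      apply: eq_forallb => u; apply: eq_forallb => v.
      by rewrite !(big_pred1 tt) // => -[].
    by move=> v /zF ->; rewrite mulr0.
  apply: dF => [y yA|v vF]; first by apply: zA; rewrite inE yA orbT.
  by have [->//|vf] := eqVneq v f; apply: zF; rewrite !inE vf.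
have [z zP] := fin_all_exists zf.
(* Both sides solve [A] and agree on [F], hence coincide. Their difference is written as a sum over
   booleans to reuse [sat_lincomb]. *)
have z0E v : z0 v = \sum_(f in F) z0 f * z f v.
  apply/eqP; rewrite -subr_eq0; apply/eqP.
  pose t b : Sg -> rat :=
    if b then z0 else fun v => \sum_(f in F) z0 f * z f v.
  have := dF (fun v => \sum_b (if b then 1 else -1) * t b v).
  rewrite /t => dF'; have := dF' _ _ v; rewrite big_bool /= mul1r mulN1r; apply.
    move=> y yA; apply: (@sat_lincomb bool t (fun b => if b then 1 else -1)).
    move=> -[] _ //=.
      exact: z0A.
    by apply: sat_lincomb => f /zP [zA _ _]; apply: zA; rewrite inE yA orbT.
  move=> w wF; rewrite big_bool /= mul1r mulN1r (bigD1 w) //=.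
  have [_ _ ->] := zP w wF; rewrite mulr1 big1 ?addr0 ?subrr // => f.
  move=> /andP[fF fw]; have [_ zF _] := zP f fF.
  by rewrite zF ?mulr0 // !inE eq_sym fw.
move/negP: z0a; apply.
have : sat (fun v => \sum_(f in F) z0 f * z f v) a.
  by apply: sat_lincomb => f /zP [zA _ _]; apply: zA; rewrite setU11.
by congr is_true; apply: eq_forallb => u; apply: eq_forallb => v; rewrite -!z0E.
Qed.

(** Induction removing the smallest edge [a]: by [nbc] the larger edges do not imply [a], so putting
    it back saves one vertex of [F]. *)
Lemma nbc_determines A : A \subset edges Sg -> nbc A ->
  exists2 F : {set Sg}, (#|F| + #|A|)%N = #|Sg| & determines F A.
Proof.
elim: {A}_.+1 {-2}A (ltnSn #|A|) => // n IH A An sAE nA.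
have [A0|[a0 a0A]] := set_0Vmem A.
  exists setT; first by rewrite A0 cards0 addn0 cardsT.
  by move=> z _ zT v; apply: zT; rewrite inE.
pose a := [arg min_(x < a0 | x \in A) enum_rank x : nat].
have [aA mina] : a \in A /\
    (forall x, x \in A -> (enum_rank a <= enum_rank x)%N).
  by rewrite /a; case: arg_minnP.
have cA : #|A| = #|A :\ a|.+1 by rewrite (cardsD1 a) aA.
have [||F FA dF] := IH (A :\ a) _ (subset_trans (subD1set A a) sAE).
- by rewrite -ltnS -cA.
- exact: nbcS (subD1set A a) nA.
have /existsNP [z /not_implyP [zA /negP za]] :
    ~ (forall z : Sg -> rat, (forall y, y \in A :\ a -> sat z y) -> sat z a).
  move=> zP; move/asboolP: nA => /(_ a (subsetP sAE a aA)); apply => z zA.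
  apply: zP => y; rewrite !inE => /andP[ya yA]; apply: zA => //.
  rewrite ltn_neqAle mina // andbT; apply: contraNneq ya => eq_rk.
  by apply/eqP/enum_rank_inj/val_inj.
have [f fF dfF] := determines_exchange dF zA za.
exists (F :\ f); last by rewrite setD1K in dfF.
by rewrite -FA cA [#|F|](cardsD1 f) fF addnS addSn.
Qed.

End EdgeEquations.

(** * Counting maps with prescribed bad edges *)

Section Counting.
Variables (Sg : signed_graph) (L : list_assignment Sg) (k : nat).
Hypotheses (Lk : k_assignment k L) (k_gt0 : (0 < k)%N).
Local Notation coloring := {dffun forall v : Sg, L v}.
Local Notation n := #|Sg|.

Definition num_sat (A : {set {set Sg}}) : nat :=
  #|[set c : coloring | [forall e in A, sat (fun v => val (c v)) e]]%SET|.

Lemma num_list_coloringsE : (num_list_colorings L)%:R =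
  \sum_(A : {set {set Sg}} | (A \subset edges Sg) && nbc A)
     (-1) ^+ #|A| * (num_sat A)%:R :> rat.
Proof.
rewrite /num_list_colorings -sum1dep_card natr_sum big_mkcond /=.
under eq_bigr => c _.
  rewrite (_ : (if _ then _ else _) = (Defs.proper (fun v => val (c v)))%:R);
    last by case: ifP.
  rewrite -sum_nbc_bad; over.
rewrite (exchange_big_dep
  (fun A : {set {set Sg}} => (A \subset edges Sg) && nbc A)) /=.
  apply: eq_bigr => A /andP[sAE nA].
  rewrite sumr_const -[LHS]mulr_natr; congr (_ * _%:R); apply: eq_card => c.
  rewrite !inE; apply/andP/forallP => [[/subsetP sA _] e|cA].
    by apply/implyP => /sA; rewrite inE => /andP[].
  split=> //; apply/subsetP => e eA; rewrite inE (subsetP sAE) //=.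
  by move: (cA e); rewrite eA.
move=> c A _ /andP[sA ->]; rewrite andbT (subset_trans sA) //.
by apply/subsetP => e; rewrite inE => /andP[].
Qed.

Lemma card_family_prod (F : forall v, pred (L v)) :
  #|(family F : simpl_pred coloring)| = (\prod_v #|F v|)%N.
Proof. by rewrite card_family foldrE big_map big_enum. Qed.

(** The factor [k ^ #|S|] on the left replaces a division in [nat]. *)
Lemma card_family_off (S : {set Sg}) (F : forall v, pred (L v)) :
  (forall v, v \notin S -> F v =i predT) ->
  (#|(family F : simpl_pred coloring)| * k ^ #|S| =
   k ^ n * \prod_(v in S) #|F v|)%N.
Proof.
move=> FS; rewrite card_family_prod (bigID (mem S)) /= mulnC mulnCA mulnC.
rewrite -(cardsC S) expnD; congr (_ * _ * _)%N.
rewrite -prod_nat_const; apply/esym; apply: eq_big => [v|v vS].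
  by rewrite inE.
by rewrite inE in vS; rewrite (eq_card (FS v vS)) -cardfE Lk.
Qed.

Definition list_elt v : L v.
Proof.
apply: (enum_val (A := predT) (Ordinal (n := _) (m := 0) _)).
by rewrite -cardfE Lk.
Defined.

Lemma num_sat_nbc (A : {set {set Sg}}) : A \subset edges Sg -> nbc A ->
  (num_sat A * k ^ #|A| <= k ^ n)%N.
Proof.
move=> sAE nA; have [F FA dF] := nbc_determines sAE nA.
pose F0 v : pred (L v) := if v \in F then predT else pred1 (list_elt v).
have := @card_family_off (~: F)%SET F0.
rewrite [X in _ = (_ * X)%N]big1 ?muln1; last first.
  by move=> v; rewrite inE /F0 => /negPf ->; rewrite card1.
have -> : #|(~: F)%SET| = #|A| by apply: (@addnI #|F|); rewrite cardsC FA.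
move=> <-; last by move=> v; rewrite inE negbK /F0 => ->.
rewrite leq_mul2r; apply/orP; right.
(* [h] forgets the colors off [F]. It is injective on satisfying colorings: if two have the same
   image, their difference solves [A] and vanishes on [F]. *)
pose h (c : coloring) : coloring :=
  finfun (fun v => if v \in F then c v else list_elt v).
rewrite /num_sat -(card_in_imset (f := h)).
  apply/subset_leq_card/subsetP => _ /imsetP[c _ ->].
  apply/familyP => v; rewrite ffunE /F0; case: ifP => // _.
  by rewrite inE.
move=> c1 c2; rewrite !inE => /forallP s1 /forallP s2 /ffunP h12.
apply/ffunP => v; apply: val_inj; apply/eqP; rewrite -subr_eq0 -(intr_eq0 rat).
rewrite intrB; apply/eqP.
pose t b v : rat := (val ((if b then c1 else c2) v))%:~R.
have := dF (fun v => \sum_b (if b then 1 else -1) * t b v) _ _ v.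
rewrite big_bool /= mul1r mulN1r; apply.
  move=> y yA; apply: (@sat_lincomb _ bool t (fun b => if b then 1 else -1)).
  by move=> -[] _; rewrite /t sat_ratr; [move: (s1 y)|move: (s2 y)]; rewrite yA.
move=> w wF; rewrite big_bool /= mul1r mulN1r /t /=.
by move: (h12 w); rewrite !ffunE wF => ->; rewrite subrr.
Qed.

(** For an edge [e = uv] its size is [|L u inter sigma e (L v)|], as multiplication by a sign is
    injective. *)
Definition compat u v : pred (L v) :=
  [pred x | sigma [set u; v]%SET * val x \in L u].
Arguments compat : clear implicits.

Lemma card_compat_le u v : (#|compat u v| <= k)%N.
Proof. by rewrite -(Lk v) cardfE max_card. Qed.

(** The color of [v] is any compatible one, that of [u] is then forced, and the other vertices are
    free. *)
Lemma num_sat1 u v : [set u; v]%SET \in edges Sg ->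
  (num_sat [set [set u; v]] * k ^ 2 = k ^ n * #|compat u v|)%N.
Proof.
move=> uvE.
have uv : u != v by move: (edges_card2 uvE); rewrite cards2; case: (u != v).
rewrite /num_sat -sum1dep_card.
rewrite (partition_big (fun c : coloring => c v) (compat u v)).
  rewrite big_distrl /= mulnC -sum_nat_const; apply: eq_bigr => x xP.
  (* [insubd] casts into [L w] and never meets its default, [x] being compatible. *)
  pose F0 w : pred (L w) :=
    if w == u then pred1 (insubd (list_elt w) (sigma [set u; v]%SET * val x))
    else if w == v then pred1 (insubd (list_elt w) (val x)) else predT.
  have := @card_family_off [set u; v]%SET F0.
  rewrite [X in _ = (_ * X)%N]big1 ?muln1; last first.
    move=> w; rewrite !inE /F0; case: ifP => _ /=; first by rewrite card1.
    by move=> ->; rewrite card1.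
  rewrite cards2 uv => <-; last first.
    by move=> w; rewrite !inE /F0 negb_or => /andP[/negPf-> /negPf->].
  rewrite sum1dep_card -cardsE; congr (_ * _)%N; apply: eq_card => c.
  rewrite !inE; apply/andP/familyP => [[/forallP cs /eqP cv] w|cF].
    have := cs [set u; v]%SET; rewrite inE eqxx sat_edge //= intz => /eqP cu.
    rewrite /F0; case: eqVneq => [->|_].
      by rewrite inE; apply/eqP/val_inj; rewrite insubdK // -cv; exact: cu.
    case: eqVneq => [->|_ //].
    by rewrite inE; apply/eqP/val_inj; rewrite insubdK ?cv //; exact: valP.
  have := cF u; rewrite /F0 eqxx => /eqP cu.
  have := cF v; rewrite /F0 eq_sym (negPf uv) eqxx => /eqP cv.
  have cvx : c v = x by apply: val_inj; rewrite cv insubdK //; exact: valP.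
  split; last exact/eqP.
  apply/forallP => e; apply/implyP; rewrite inE => /eqP ->.
  by rewrite sat_edge // cu insubdK // cvx intz.
move=> c /forallP/(_ [set u; v]%SET).
rewrite inE eqxx sat_edge //= intz => /eqP cu.
by rewrite /compat /= -cu; exact: valP.
Qed.

(** Each of [u] and [w] lies on one of the two edges only, so [v] and [x] (possibly equal) force
    their colors. From the [k ^ (n - 2)] choices off [u] and [w], a union bound removes those where
    [v] or [x] has no partner color; everything is scaled by [k ^ 3]. *)
Lemma num_sat2 u v w x : [set u; v]%SET \in edges Sg ->
  [set w; x]%SET \in edges Sg -> u \notin [set w; x]%SET ->
  w \notin [set u; v]%SET ->
  (k ^ n * k <= num_sat [set [set u; v]; [set w; x]] * k ^ 3
     + k ^ n * (k - #|compat u v|) + k ^ n * (k - #|compat w x|))%N.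
Proof.
move=> uvE wxE; rewrite !inE !negb_or => /andP[uw ux] /andP[wu wv].
have uv : u != v by move: (edges_card2 uvE); rewrite cards2; case: (u != v).
have wx : w != x by move: (edges_card2 wxE); rewrite cards2; case: (w != x).
pose F0 y : pred (L y) :=
  if (y == u) || (y == w) then pred1 (list_elt y) else predT.
pose F1 y : pred (L y) :=
  if (y == u) || (y == w) then pred1 (list_elt y)
  else if y == v then [predC compat u y] else predT.
pose F2 y : pred (L y) :=
  if (y == u) || (y == w) then pred1 (list_elt y)
  else if y == x then [predC compat w y] else predT.
have c0 : (#|(family F0 : simpl_pred coloring)| * k ^ 2 = k ^ n)%N.
  have := @card_family_off [set u; w]%SET F0.
  rewrite big1 ?muln1 ?cards2 ?uw.
    by apply=> y; rewrite !inE /F0 => /negPf->.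
  by move=> y; rewrite !inE /F0 => ->; rewrite card1.
have cC a y : #|[predC compat a y]| = (k - #|compat a y|)%N.
  by rewrite -(Lk y) cardfE -(cardC (compat a y)) addKn.
have c1 : (#|(family F1 : simpl_pred coloring)| * k ^ 3 =
           k ^ n * (k - #|compat u v|))%N.
  have := @card_family_off (v |: [set u; w])%SET F1.
  rewrite cardsU1 cards2 uw !inE negb_or ![v == _]eq_sym uv wv /=.
  rewrite big_setU1 ?inE ?negb_or ?[v == _]eq_sym ?uv ?wv //=.
  rewrite [F1 v]/F1 ![v == _]eq_sym (negPf uv) (negPf wv) /= eqxx cC.
  rewrite big1 ?muln1.
    by apply=> y; rewrite !inE /F1 negb_or => /andP[/negPf-> /negPf->].
  by move=> y; rewrite !inE /F1 => ->; rewrite card1.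
have c2 : (#|(family F2 : simpl_pred coloring)| * k ^ 3 =
           k ^ n * (k - #|compat w x|))%N.
  have := @card_family_off (x |: [set u; w])%SET F2.
  rewrite cardsU1 cards2 uw !inE negb_or ![x == _]eq_sym ux wx /=.
  rewrite big_setU1 ?inE ?negb_or ?[x == _]eq_sym ?ux ?wx //=.
  rewrite [F2 x]/F2 ![x == _]eq_sym (negPf ux) (negPf wx) /= eqxx cC.
  rewrite big1 ?muln1.
    by apply=> y; rewrite !inE /F2 negb_or => /andP[/negPf-> /negPf->].
  by move=> y; rewrite !inE /F2 => ->; rewrite card1.
rewrite -c1 -c2 -{1}c0 -mulnA -expnSr -!mulnDl leq_mul2r; apply/orP; right.
pose good := [set c : coloring |
  [&& c \in family F0, c \notin family F1 & c \notin family F2]]%SET.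
suff: (#|good| <= num_sat [set [set u; v]; [set w; x]])%N.
  move=> le_good.
  apply: (@leq_trans (#|good| + #|(family F1 : simpl_pred coloring)|
                      + #|(family F2 : simpl_pred coloring)|));
    last by rewrite !leq_add2r.
  pose G1 := [set c : coloring | c \in family F1]%SET.
  pose G2 := [set c : coloring | c \in family F2]%SET.
  have <- : #|G1| = #|(family F1 : simpl_pred coloring)| by rewrite cardsE.
  have <- : #|G2| = #|(family F2 : simpl_pred coloring)| by rewrite cardsE.
  apply: leq_trans (leq_add (leq_card_setU good G1) (leqnn #|G2|)).
  apply: leq_trans (leq_card_setU _ _); apply/subset_leq_card/subsetP => c cF.
  rewrite 2!in_setU 3!in_set cF.
  by case: (_ \in family F1); case: (_ \in family F2).
(* Recoloring [u] and [w] by their forced colors makes both edges bad; on [good] these colors lie in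
   the lists. *)
pose z (c : coloring) y : int :=
  if y == u then sigma [set u; v]%SET * val (c v)
  else if y == w then sigma [set w; x]%SET * val (c x) else val (c y).
pose h (c : coloring) : coloring := finfun (fun y => insubd (c y) (z c y)).
have goodP c : c \in good ->
    [/\ c u = list_elt u, c w = list_elt w, compat u v (c v)
      & compat w x (c x)].
  rewrite inE => /and3P[/familyP cF cF1 cF2].
  have cu := cF u; rewrite /F0 eqxx in cu.
  have cw := cF w; rewrite /F0 eqxx orbT in cw.
  split; [exact/eqP|exact/eqP| |].
    apply: contraNT cF1 => ncv; apply/familyP => y; have := cF y.
    by rewrite /F0 /F1; case: ifP => // _ _; case: eqVneq => // ->.
  apply: contraNT cF2 => ncx; apply/familyP => y; have := cF y.
  by rewrite /F0 /F2; case: ifP => // _ _; case: eqVneq => // ->.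
have hE c y : c \in good -> val (h c y) = z c y.
  move=> /goodP [cu cw cv cx]; rewrite ffunE insubdK // /z.
  case: eqVneq => [->//|_]; case: eqVneq => [->//|_]; exact: valP.
rewrite -(card_in_imset (f := h)); last first.
  move=> c d cG dG /ffunP hcd; apply/ffunP => y; apply: val_inj.
  have [cu cw _ _] := goodP c cG; have [du dw _ _] := goodP d dG.
  have [->|yu] := eqVneq y u; first by rewrite cu du.
  have [->|yw] := eqVneq y w; first by rewrite cw dw.
  by have := hE c y cG; rewrite hcd hE // /z (negPf yu) (negPf yw).
apply/subset_leq_card/subsetP => _ /imsetP[c cG ->]; rewrite inE.
apply/forallP => e; apply/implyP; rewrite !inE => /orP[] /eqP->;
  rewrite sat_edge // !hE // /z intz.
  by rewrite eqxx ![v == _]eq_sym (negPf uv) (negPf wv).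
by rewrite eqxx ![x == _]eq_sym (negPf ux) (negPf wx) (negPf wu).
Qed.

End Counting.
Arguments compat {Sg} L u v.

(** * Comparison with a consistent assignment *)

Section SubsetSums.
Variables (T : finType) (E : {set T}).
Local Notation m := #|E|.

Lemma sum_subsets_by_card (R : pzSemiRingType) (f : nat -> R) :
  \sum_(A : {set T} | A \subset E) f #|A| =
  \sum_(0 <= i < m.+1) 'C(m, i)%:R * f i.
Proof.
rewrite big_mkord.
rewrite (partition_big (fun A : {set T} => inord #|A| : 'I_m.+1) xpredT) //=.
apply: eq_bigr => i _; rewrite -cards_draws mulr_natl -sumr_const.
apply: eq_big => [A|A /andP[sA /eqP <-]]; last first.
  by rewrite inordK // ltnS subset_leq_card.
rewrite inE; have [sA|//] := boolP (A \subset E).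
by rewrite -val_eqE /= inordK // ltnS subset_leq_card.
Qed.

Lemma card_draws_containing e j : e \in E ->
  #|[set A : {set T} | (A \subset E) && (#|A| == j.+1) & e \in A]%SET| =
  'C(m.-1, j).
Proof.
move=> eE; have -> : m.-1 = #|E :\ e| by rewrite (cardsD1 e E) eE.
rewrite -cards_draws -[RHS](card_in_imset (f := fun B : {set T} => e |: B)%SET).
  apply: eq_card => A; rewrite inE; apply/idP/imsetP.
    move=> /andP[/andP[sA cA] eA]; exists (A :\ e)%SET; last by rewrite setD1K.
    by rewrite inE setSD //=; move: cA; rewrite (cardsD1 e) eA add1n eqSS.
  case=> B.
  rewrite inE subsetD1 => /andP[/andP[sB eB] /eqP cB] ->.
  by rewrite subUset sub1set eE sB cardsU1 eB cB eqxx setU11.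
move=> B1 B2; rewrite !inE !subsetD1.
move=> /andP[/andP[_ e1] _] /andP[/andP[_ e2] _] e12.
by rewrite -(setU1K e1) e12 setU1K.
Qed.

Lemma sum_subsets_sum (R : pzSemiRingType) (d : T -> R) j :
  \sum_(A : {set T} | (A \subset E) && (#|A| == j.+1)) \sum_(e in A) d e =
  (\sum_(e in E) d e) *+ 'C(m.-1, j).
Proof.
rewrite (exchange_big_dep (mem E)) /=; last first.
  by move=> A e /andP[/subsetP sA _] /sA.
rewrite -sumrMnl; apply: eq_bigr => e eE.
rewrite sumr_const -(card_draws_containing j eE); congr (_ *+ _).
by apply: eq_card => A; rewrite !inE.
Qed.

End SubsetSums.

(** Consecutive terms have ratio [(m - r) / ((r + 1) K)], at most [1/2] since [r >= 1] and [m <= K];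
    a geometric series dominates. *)
Lemma binomial_tail (m r : nat) (K : rat) : (0 < r)%N -> m%:R <= K -> 0 < K ->
  \sum_(r <= i < m.+1) 'C(m, i)%:R / K ^+ i <= 2 * 'C(m, r)%:R / K ^+ r.
Proof.
move=> r_gt0 mK K_gt0.
elim: {r}(m.+1 - r)%N {-2}r (erefl (m.+1 - r)%N) r_gt0 => [|j IH] r jr r_gt0.
  rewrite big_geq; last by rewrite -subn_eq0 jr.
  by rewrite divr_ge0 ?exprn_ge0 ?mulr_ge0 ?ler0n // ltW.
rewrite big_ltn; last by rewrite -subn_gt0 jr.
have /IH /(_ isT) {}IH : (m.+1 - r.+1)%N = j by rewrite subnS jr.
apply: le_trans (lerD (lexx _) IH) _.
have : 2 * 'C(m, r.+1)%:R <= K * 'C(m, r)%:R.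
  apply: le_trans (_ : m%:R * 'C(m, r)%:R <= _); last first.
    by rewrite ler_wpM2r // ler0n.
  rewrite -!natrM ler_nat; have := mul_bin_left m r.
  have : ((m - r) * 'C(m, r) <= m * 'C(m, r))%N.
    by rewrite leq_mul2r leq_subr orbT.
  by nia.
have Kr : 0 < K ^+ r by rewrite exprn_gt0.
move=> h; rewrite exprS.
have -> : 2 * 'C(m, r)%:R / K ^+ r =
    ('C(m, r)%:R / K ^+ r) + (K * 'C(m, r)%:R) / (K * K ^+ r).
  by field; rewrite !gt_eqF.
by rewrite lerD2l ler_pM2r // invr_gt0 mulr_gt0.
Qed.

(** * Term-by-term comparison of the two expansions *)

Section Comparison.
Variables (Sg : signed_graph) (k : nat) (L C : list_assignment Sg).
Hypotheses (Lk : k_assignment k L) (Ck : k_assignment k C) (k_gt0 : (0 < k)%N).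
Hypothesis C_compat : forall u v : Sg, [set u; v]%SET \in edges Sg ->
  #|compat C u v| = k.
Local Notation n := #|Sg|.
Local Notation m := #|edges Sg|.
Local Notation K := (k%:R : rat).
Local Notation W := (K ^+ n).
Implicit Types (e : {set Sg}) (A : {set {set Sg}}).

Let K_gt0 : 0 < K. Proof. by rewrite ltr0n. Qed.
Let W_gt0 : 0 < W. Proof. by rewrite exprn_gt0. Qed.
Let KN0 : K != 0. Proof. by rewrite gt_eqF. Qed.
Let WN0 : W != 0. Proof. by rewrite gt_eqF. Qed.

(* The fraction of the list of [v] with no match across the edge [e = uv]. *)
Definition defect e : rat := 1 - (num_sat L [set e])%:R * K / W.

Lemma num_sat1_rat (L' : list_assignment Sg) u v : k_assignment k L' ->
  [set u; v]%SET \in edges Sg ->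
  (num_sat L' [set [set u; v]%SET]%SET)%:R = W * #|compat L' u v|%:R / K ^+ 2.
Proof.
move=> L'k uvE; have := num_sat1 L'k k_gt0 uvE.
move=> /(congr1 (fun i : nat => i%:R : rat)).
by rewrite !natrM !natrX => <-; field.
Qed.

(** So [defect e] is [d e / k]; its definition through [num_sat] involves no order of the
    endpoints. *)
Lemma defectE u v : [set u; v]%SET \in edges Sg ->
  defect [set u; v]%SET = (k - #|compat L u v|)%:R / K.
Proof.
move=> uvE; rewrite /defect num_sat1_rat // natrB ?card_compat_le //.
by field; apply/andP; split; [exact: KN0|exact: WN0].
Qed.

Lemma defect_ge0 e : e \in edges Sg -> 0 <= defect e.
Proof.
move=> eE; have [u [v [_ euv]]] := edge_endpoints eE.
by rewrite euv defectE -?euv // divr_ge0 // ler0n.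
Qed.

Lemma num_sat_nbc_rat (L' : list_assignment Sg) A : k_assignment k L' ->
  A \subset edges Sg -> nbc A -> (num_sat L' A)%:R <= W / K ^+ #|A|.
Proof.
move=> L'k sA nA; rewrite ler_pdivlMr ?exprn_gt0 // -!natrX -natrM ler_nat.
exact: num_sat_nbc.
Qed.

Lemma num_sat_set0 (L' : list_assignment Sg) : k_assignment k L' ->
  (num_sat L' set0)%:R = W.
Proof.
move=> L'k; rewrite -natrX; congr _%:R.
have := @card_family_off _ _ _ L'k set0 (fun v => predT).
rewrite cards0 expn0 muln1 big_set0 muln1 => <- //; apply: eq_card => c.
rewrite inE; apply/forallP/familyP => _ //= e.
by rewrite inE.
Qed.

(** For [nbc] sets, a lower bound, divided by [k ^ n], on the signed change of the count from [C] to
    [L]. *)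
Definition weight A : rat :=
  (if #|A| == 1%N then (\sum_(e in A) defect e) / K else 0)
  - (if #|A| == 2%N then (\sum_(e in A) defect e) / K ^+ 2 else 0)
  - (if (2 < #|A|)%N then (K ^+ #|A|)^-1 else 0).

(** One edge gives equality. For two edges, [num_sat2] bounds the [L] count below and [num_sat_nbc]
    the [C] count above. For larger sets both counts lie between 0 and [k ^ (n - |A|)]. *)
Lemma weight_le A : A \subset edges Sg -> nbc A ->
  W * weight A <= (-1) ^+ #|A| * ((num_sat L A)%:R - (num_sat C A)%:R).
Proof.
move=> sA nA; have NC := num_sat_nbc_rat Ck sA nA.
have NL := num_sat_nbc_rat Lk sA nA; rewrite /weight.
have [A0|A1] := posnP #|A|.
  have -> : A = set0 by apply/eqP; rewrite -cards_eq0 A0.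
  by rewrite !num_sat_set0 // cards0 /= !subrr !mulr0.
have [cA1|cA1] := eqVneq #|A| 1%N.
  have /eqP/cards1P [e Ae] := cA1; rewrite cA1 /= !subr0 expr1.
  have eE : e \in edges Sg by rewrite -sub1set -Ae.
  have [u [v [_ euv]]] := edge_endpoints eE.
  rewrite Ae big_set1 /defect; subst e; rewrite !num_sat1_rat // C_compat //.
  rewrite le_eqVlt; apply/orP; left; apply/eqP; field.
  by apply/andP; split; [exact: KN0|exact: WN0].
have [cA2|cA2] := eqVneq #|A| 2%N.
  rewrite cA2 /= sqrrN expr1n mul1r; rewrite cA2 in NC.
  have /eqP/cards2P [e [f [ef Aef]]] := cA2.
  have eE : e \in edges Sg by rewrite (subsetP sA) // Aef set21.
  have fE : f \in edges Sg by rewrite (subsetP sA) // Aef set22.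
  rewrite Aef big_setU1 ?inE //= big_set1 -Aef.
  (* Distinct edges have equal size, so each has an endpoint off the other, as [num_sat2]
     demands. *)
  have diff (a b : {set Sg}) : a \in edges Sg -> b \in edges Sg -> a != b ->
      exists u v, a = [set u; v]%SET /\ u \notin b.
    move=> aE bE ab; have /subsetPn [u ua ub] : ~~ (a \subset b).
      apply: contra ab => ab.
      by rewrite eqEcard ab (edges_card2 aE) (edges_card2 bE).
    have [x [y [_ axy]]] := edge_endpoints aE; move: ua.
    rewrite axy !inE => /orP[]/eqP ux; first by exists x, y; rewrite -ux.
    by exists y, x; rewrite setUC -ux.
  have [u [v [euv uf]]] := diff e f eE fE ef.
  have fe : f != e by rewrite eq_sym.
  have [w [x [fwx we]]] := diff f e fE eE fe.
  rewrite euv in eE we; rewrite fwx in fE uf.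
  have := num_sat2 Lk k_gt0 eE fE uf we.
  rewrite -euv -fwx -Aef -(ler_nat rat) !natrD !natrM !natrX.
  rewrite euv fwx !defectE //.
  set d1 := (k - _)%:R; set d2 := (k - _)%:R.
  move=> h; set N' := (num_sat C A)%:R in NC *.
  have -> : W * (0 - (d1 / K + d2 / K) / K ^+ 2 - 0) =
      (W * K - W * d1 - W * d2) / K ^+ 3 - W / K ^+ 2 by field.
  apply: lerB; last exact: NC.
  by rewrite ler_pdivrMr ?exprn_gt0 // !lerBlDr addrAC.
have cA3 : (2 < #|A|)%N by lia.
rewrite cA3 subr0 sub0r mulrN.
have := ler0n rat (num_sat L A); have := ler0n rat (num_sat C A).
move: NL NC; set x := _%:R; set y := (num_sat C A)%:R; set b := W / _.
rewrite -signr_odd; move: x y b => x y b.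
by case: (odd _); rewrite ?expr1 ?expr0; lra.
Qed.

(** Only single edges can have positive weight, and they are [nbc]. Hence the sum can be extended to
    all edge sets, where it has a closed form. *)
Lemma weight_le0 A : A \subset edges Sg -> ~~ nbc A -> weight A <= 0.
Proof.
move=> sA nA; rewrite /weight ifN.
  rewrite sub0r -opprD oppr_le0 addr_ge0 //; case: ifP => _ //.
    apply: divr_ge0; last by rewrite exprn_ge0 // ltW.
    apply: sumr_ge0 => e eA.
    by rewrite defect_ge0 // (subsetP sA).
  by rewrite invr_ge0 exprn_ge0 // ltW.
apply: contra nA => /cards1P [e Ae]; rewrite Ae nbc_set1 //.
by rewrite -sub1set -Ae.
Qed.

Lemma sum_weight : \sum_(A : {set {set Sg}} | A \subset edges Sg) weight A =
  (\sum_(e in edges Sg) defect e) / K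
  - (\sum_(e in edges Sg) defect e) *+ m.-1 / K ^+ 2
  - \sum_(3 <= i < m.+1) 'C(m, i)%:R / K ^+ i.
Proof.
set D := \sum_(e in _) defect e.
rewrite !sumrB -!big_mkcondr /=; congr (_ - _ - _).
- by rewrite -mulr_suml sum_subsets_sum bin0 mulr1n.
- by rewrite -mulr_suml sum_subsets_sum bin1.
rewrite big_mkcondr /=.
pose g i := if (2 < i)%N then (K ^+ i)^-1 else 0.
rewrite (sum_subsets_by_card _ g) /g {g}.
have [m3|m3] := leqP 3 m.+1.
  rewrite (big_cat_nat _ m3) //= big_nat big1 ?add0r; last first.
    by move=> i /andP[_ i3]; rewrite leqNgt i3 mulr0.
  by apply: eq_big_nat => i /andP[-> _].
rewrite [RHS]big_geq 1?ltnW // big_nat big1 // => i /andP[_ im].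
by rewrite ifN ?mulr0 // -leqNgt -ltnS (leq_trans im) // ltnW.
Qed.

Lemma num_list_colorings_lt u v : [set u; v]%SET \in edges Sg ->
  (#|compat L u v| < k)%N ->
  ('C(m, 3) + 'C(m, 4) + m <= k)%N ->
  (num_list_colorings C < num_list_colorings L)%N.
Proof.
move=> uvE uvL km.
have m_gt0 : (0 < m)%N by apply/card_gt0P; exists [set u; v]%SET.
rewrite -(ltr_nat rat) -subr_gt0 !num_list_coloringsE -sumrB.
under eq_bigr => A _ do rewrite -mulrBr.
apply: lt_le_trans (_ : \sum_(A : {set {set Sg}} |
    (A \subset edges Sg) && nbc A) W * weight A <= _); last first.
  by apply: ler_sum => A /andP[]; apply: weight_le.
rewrite -mulr_sumr pmulr_rgt0 //.
apply: lt_le_trans (_ : \sum_(A : {set {set Sg}} | A \subset edges Sg)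
    weight A <= _); last first.
  rewrite (bigID (@nbc Sg)) /= -[leRHS]addr0 lerD2l.
  by apply: sumr_le0 => A /andP[]; apply: weight_le0.
rewrite sum_weight; set D := \sum_(e in _) _.
have D_ge : 1 / K <= D.
  rewrite /D (bigD1 [set u; v]%SET) //= -[leLHS]addr0 lerD //.
    by rewrite defectE // ler_pM2r ?invr_gt0 // ler1n subn_gt0.
  by rewrite sumr_ge0 // => e /andP[/defect_ge0].
(* The term [i = 3] is kept; the rest is at most [2 'C(m, 4) / K ^ 4], and one factor [K >= 2]
   absorbs the 2. *)
have tail : \sum_(3 <= i < m.+1) 'C(m, i)%:R / K ^+ i <=
    ('C(m, 3) + 'C(m, 4))%:R / K ^+ 3.
  have [m4|m4] := ltnP m 3.
    by rewrite big_geq // divr_ge0 ?exprn_ge0 ?ler0n.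
  rewrite big_ltn // natrD mulrDl lerD2l.
  apply: le_trans (binomial_tail _ _ _) _ => //; first by rewrite ler_nat; lia.
  rewrite [K ^+ 4]exprSr invfM mulrA [leLHS]mulrAC.
  rewrite ler_wpM2r ?invr_ge0 ?exprn_ge0 //.
  by rewrite ler_pdivrMr // mulrC ler_wpM2l ?ler0n // ler_nat; lia.
have : D * (K - m.-1%:R) / K ^+ 2 > ('C(m, 3) + 'C(m, 4))%:R / K ^+ 3.
  (* The bound on [k] leaves one unit beyond the numerator of the tail, which makes the inequality
     strict. *)
  have h : ('C(m, 3) + 'C(m, 4)).+1%:R <= K - m.-1%:R.
    by rewrite lerBrDr -natrD ler_nat; lia.
  apply: lt_le_trans (_ : ('C(m, 3) + 'C(m, 4)).+1%:R / K ^+ 3 <= _).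
    by rewrite ltr_pM2r ?invr_gt0 ?exprn_gt0 // ltr_nat.
  have -> : ('C(m, 3) + 'C(m, 4)).+1%:R / K ^+ 3 =
      1 / K * ('C(m, 3) + 'C(m, 4)).+1%:R / K ^+ 2 by field.
  rewrite ler_pM2r ?invr_gt0 ?exprn_gt0 // ler_pM ?ler0n //.
  by rewrite divr_ge0 // ltW.
have -> : D * (K - m.-1%:R) / K ^+ 2 = D / K - D *+ m.-1 / K ^+ 2.
  by rewrite -mulr_natr; field.
move=> lt_D; rewrite subr_gt0; exact: le_lt_trans tail lt_D.
Qed.

End Comparison.

(** * Consistent assignments *)

Section Sign.
Implicit Types (s t a : int) (A : {fset int}).

Definition is_sign s := s = 1 \/ s = -1.

Lemma is_signM s t : is_sign s -> is_sign t -> is_sign (s * t).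
Proof.
by case=> -> [] ->; rewrite ?mulN1r ?mul1r ?opprK; [left|right|right|left].
Qed.

Lemma is_sign_sqr s : is_sign s -> s * s = 1.
Proof. by case=> ->. Qed.

Lemma signMK s : is_sign s -> involutive ( *%R s).
Proof. by move=> ss a; rewrite mulrA is_sign_sqr // mul1r. Qed.

Lemma mem_scale_set s A a : is_sign s -> (a \in scale_set s A) = (s * a \in A).
Proof.
move=> ss; apply/imfsetP/idP => [[b bA ->]|saA]; first by rewrite signMK.
by exists (s * a); rewrite //= signMK.
Qed.

Lemma scale_set1 A : scale_set 1 A = A.
Proof. by apply/fsetP => a; rewrite mem_scale_set ?mul1r //; left. Qed.

Lemma scale_setM s t A : is_sign s -> is_sign t ->
  scale_set (s * t) A = scale_set s (scale_set t A).
Proof.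
move=> ss st; apply/fsetP => a; rewrite !mem_scale_set //; last exact: is_signM.
by rewrite mulrA [s * t]mulrC.
Qed.

Lemma scale_setK s A B : is_sign s -> A = scale_set s B -> B = scale_set s A.
Proof. by move=> ss ->; rewrite -scale_setM // is_sign_sqr // scale_set1. Qed.

Lemma sign_neq s t : is_sign s -> is_sign t -> s != t -> s = - t.
Proof. by case=> -> [] ->. Qed.

Lemma mem_M k a : (a \in M k) = (`|a| <= k./2)%N && ((a != 0) || odd k).
Proof.
rewrite /M !in_fsetU mem_scale_setN !mem_pos_colors.
by case: (odd k); rewrite ?in_fset1 ?in_fset0; apply/idP/idP; lia.
Qed.

Lemma oppM k a : (- a \in M k) = (a \in M k).
Proof. by rewrite !mem_M abszN oppr_eq0. Qed.

Lemma signM_M k s a : is_sign s -> (s * a \in M k) = (a \in M k).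
Proof. by case=> ->; rewrite ?mul1r ?mulN1r ?oppM. Qed.

Lemma size_signs (r : seq int) : size r =
  (count (fun a => (0 < a)%R) r + count (fun a => (a < 0)%R) r
   + count_mem 0%R r)%N.
Proof. by elim: r => //= a r ->; case: ltrgtP; lia. Qed.

(** Negation matches the positive elements with the negative ones, leaving at most 0. *)
Lemma symmetric_count A : A = scale_set (-1) A ->
  count (fun a => 0 < a) A = #|` A|./2 /\ odd #|` A| = (0 \in A).
Proof.
move=> symA.
have mA a : (- a \in A) = (a \in A) by rewrite {2}symA mem_scale_setN.
have pA : perm_eq A (map -%R A).
  apply: uniq_perm; rewrite ?fset_uniq ?map_inj_uniq ?fset_uniq //.
    exact: oppr_inj.
  move=> a; rewrite -[a in RHS]opprK mem_map; first by rewrite mA.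
  exact: oppr_inj.
have neg : count (fun a => a < 0) A = count (fun a => 0 < a) A.
  rewrite (permP pA) count_map; apply: eq_count => a /=; exact: oppr_lt0.
have := size_signs A; rewrite neg count_uniq_mem ?fset_uniq //.
have -> : size A = #|` A| by [].
by case: (0 \in _); lia.
Qed.

(** For symmetric [A], send [i] and [- i] to plus and minus the [i]-th positive element, and 0 to 0;
    [symmetric_count] makes this land in [A]. Otherwise match positions in the two enumerations. *)
Lemma odd_injection A k : #|` A| = k -> exists f : int -> int,
  [/\ {in M k &, injective f}, forall a, a \in M k -> f a \in A
    & A = scale_set (-1) A -> forall a, f (- a) = - f a].
Proof.
move=> cA; have [/eqP symA|nsymA] := boolP (A == scale_set (-1) A).
  have [cP oA] := symmetric_count symA; rewrite cA in cP oA.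
  pose P := [seq a <- (A : seq int) | 0 < a].
  have sP : size P = k./2 by rewrite size_filter.
  have uP : uniq P by rewrite filter_uniq ?fset_uniq.
  (* Positions start at 0 whereas nonzero absolute values start at 1; at [a = 0] the factor [sgz a]
     erases the value. *)
  pose g a := nth 0 P (`|a|%N.-1).
  have gP a : a \in M k -> a != 0 -> g a \in P.
    by rewrite mem_M => aM a0; apply: mem_nth; rewrite sP; lia.
  have gE a : a \in M k -> a != 0 -> (0 < g a) * (g a \in A).
    by move=> aM a0; have := gP a aM a0; rewrite mem_filter => /andP[-> ->].
  have mA a : (- a \in A) = (a \in A) by rewrite {2}symA mem_scale_setN.
  exists (fun a => sgz a * g a); split.
  - have ginj a b : a \in M k -> b \in M k -> a != 0 -> b != 0 -> g a = g b ->
        `|a|%N = `|b|%N.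
      rewrite !mem_M => aM bM a0 b0 /eqP; rewrite nth_uniq ?sP //; lia.
    move=> a b aM bM.
    have [->|a0] := eqVneq a 0; have [->|b0] := eqVneq b 0 => //.
    + have := gE b bM b0; case=> + _; case: (sgzP b) b0 => //; lia.
    + have := gE a aM a0; case=> + _; case: (sgzP a) a0 => //; lia.
    have := ginj a b aM bM a0 b0.
    have [ga _] := gE a aM a0; have [gb _] := gE b bM b0.
    by case: (sgzP a) a0 => //; case: (sgzP b) b0 => //; lia.
  - move=> a aM; have [a0|a0] := eqVneq a 0.
      by move: aM; rewrite a0 mem_M eqxx sgz0 mul0r -oA => /andP[].
    have [_ gA] := gE a aM a0.
    by case: (sgzP a) a0 => // _ _; rewrite ?mul1r ?mulN1r ?mA.
  - by move=> _ a; rewrite sgzN mulNr /g abszN.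
pose g a := nth 0 (A : seq int) (index a (M k)).
have iM a : a \in M k -> (index a (M k) < size A)%N.
  have -> : size A = size (M k) by rewrite -!/(#|` _|) cA card_M.
  by rewrite index_mem.
exists g; split=> [a b aM bM /eqP|a aM|symA].
- rewrite nth_uniq ?iM ?fset_uniq // => /eqP /(congr1 (nth 0 (M k : seq int))).
  by rewrite !nth_index.
- by rewrite mem_nth ?iM.
- by rewrite -symA eqxx in nsymA.
Qed.

End Sign.

Lemma compat_full (Sg : signed_graph) (L : list_assignment Sg) (k : nat)
    (Lk : k_assignment k L) u v : [set u; v]%SET \in edges Sg ->
  (k <= #|compat L u v|)%N -> L u = scale_set (sigma [set u; v]%SET) (L v).
Proof.
move=> uvE kc; have sS : is_sign (sigma [set u; v]%SET) := sigma_pm1 uvE.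
have full x : x \in L v -> sigma [set u; v]%SET * x \in L u.
  move=> xL; have : #|[predC compat L u v]| = 0%N.
    have := cardC (compat L u v); rewrite -cardfE Lk => cC.
    apply/eqP; rewrite -(eqn_add2l #|compat L u v|) cC addn0 eqn_leq kc.
    exact: card_compat_le.
  by move=> /card0_eq /(_ [` xL]%fset); rewrite !inE /= => /negbFE.
apply/esym/eqP; rewrite eqEfcard; apply/andP; split.
  by apply/fsubsetP => a; rewrite mem_scale_set // => /full; rewrite signMK.
rewrite Lk card_imfset /= ?[size _](Lk v) //; exact: inv_inj (signMK sS).
Qed.

Lemma compat_M (Sg : signed_graph) k (u v : Sg) : [set u; v]%SET \in edges Sg ->
  #|compat (fun _ : Sg => M k) u v| = k.
Proof.
move=> uvE; rewrite -[RHS](card_M k) cardfE; apply: eq_card => x.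
have sxM : sigma [set u; v]%SET * val x \in M k.
  by rewrite signM_M ?(valP x) //; exact: sigma_pm1.
by rewrite [RHS]inE; exact: sxM.
Qed.

(** The default [x] of [nth] gives the wrap-around from the last vertex to the head. *)
Lemma next_uniq_nth (T : eqType) (x : T) (q : seq T) i : uniq (x :: q) ->
  (i < (size q).+1)%N -> next (x :: q) (nth x (x :: q) i) = nth x q i.
Proof. by move=> uq iq; rewrite next_nth mem_nth // index_uniq. Qed.

(** Lets the edges of a cycle be counted by its vertices. At length 2 it would fail, both arcs being
    the same edge. *)
Lemma cycle_edge_inj (T : finType) (p : seq T) : uniq p -> (2 < size p)%N ->
  {in p &, injective (fun y => [set y; next p y]%SET)}.
Proof.
case: p => // x q uq sq y z /(nthP x) [i ip <-] /(nthP x) [j jp <-].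
have nE l : (l < (size q).+1)%N -> next (x :: q) (nth x (x :: q) l) =
    nth x (x :: q) (if (l < size q)%N then l.+1 else 0%N).
  move=> lq; rewrite next_uniq_nth //; case: ltnP => // ql.
  by rewrite nth_default.
rewrite !nE // => /setP eqS; apply/eqP; rewrite nth_uniq //.
have := eqS (nth x (x :: q) i); rewrite !inE eqxx /= => /esym.
have := eqS (nth x (x :: q) j); rewrite !inE eqxx /=.
rewrite /= in sq ip jp.
by case: (ltnP i (size q)) => iq; case: (ltnP j (size q)) => jq;
  rewrite !nth_uniq //= ?ltnS //; lia.
Qed.

(** * Lists that agree up to sign along every edge *)

Section Consistent.
Variables (Sg : signed_graph) (L : list_assignment Sg).
Hypothesis L_consistent : forall u v : Sg, [set u; v]%SET \in edges Sg ->
  L u = scale_set (sigma [set u; v]%SET) (L v).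

Lemma connect_scale u v : connect (@adj Sg) u v ->
  exists2 s, is_sign s & L v = scale_set s (L u).
Proof.
move=> /connectP [p pP ->] {v}; elim: p u pP => [|w p IH] u /=.
  by exists 1; [left|rewrite scale_set1].
move=> /andP[uw /IH [s ss ->]]; have sS := sigma_pm1 uw.
exists (s * sigma [set u; w]%SET); first exact: is_signM.
by rewrite scale_setM // -(scale_setK sS (L_consistent uw)).
Qed.

Lemma adj_sym : symmetric (@adj Sg).
Proof. by move=> u v; rewrite /adj setUC. Qed.

Lemma num_list_colorings_consistent k :
  k_assignment k L -> (0 < k)%N ->
  (num_list_colorings (fun _ : Sg => M k) <= num_list_colorings L)%N.
Proof.
move=> Lk k_gt0.
have csym : connect_sym (@adj Sg) := sym_connect_sym adj_sym.
have sign_ex v : exists s,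
    is_sign s /\ L v = scale_set s (L (fingraph.root (@adj Sg) v)).
  have : connect (@adj Sg) (fingraph.root (@adj Sg) v) v.
    by rewrite csym connect_root.
  by move=> /connect_scale [s ss Ls]; exists s.
have [s0 /all_and2 [s0_sign s0L]] := fin_all_exists sign_ex.
have [f fP] := fin_all_exists (fun r : Sg => odd_injection (Lk r)).
pose r v := fingraph.root (@adj Sg) v.
(* Switch each vertex by the sign relating its list to that of its root, apply the injection of the
   root, and switch back. *)
pose z (c : Sg -> int) v := s0 v * f (r v) (s0 v * c v).
have zL (c : Sg -> int) v : c v \in M k -> z c v \in L v.
  move=> cM; rewrite s0L mem_scale_set // signMK //.
  by have [_ fL _] := fP (r v); apply: fL; rewrite signM_M.
pose h (c : {dffun forall v : Sg, M k}) : {dffun forall v : Sg, L v} :=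
  finfun (fun v => insubd (list_elt Lk k_gt0 v) (z (fun v => val (c v)) v)).
have hE c v : val (h c v) = z (fun v => val (c v)) v.
  by rewrite ffunE insubdK //; apply: zL; exact: valP.
rewrite /num_list_colorings -(card_in_imset (f := h)); last first.
  move=> c d _ _ /ffunP hcd; apply/ffunP => v; apply: val_inj.
  have /(congr1 val) := hcd v; rewrite !hE /z.
  move=> /(can_inj (signMK (s0_sign v))).
  have [finj _ _] := fP (r v); move/finj; rewrite !signM_M //.
  by move=> /(_ (valP (c v)) (valP (d v))) /(can_inj (signMK (s0_sign v))).
apply/subset_leq_card/subsetP => _ /imsetP [c + ->]; rewrite !inE.
move=> /forallP cP; apply/forallP => u; apply/forallP => v; apply/implyP => uv.
have := forallP (cP u) v; rewrite uv /=; apply: contra; rewrite !hE /z.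
have ruv : r u = r v.
  by apply/eqP; rewrite /r root_connect // connect1.
rewrite ruv; have [finj _ fodd] := fP (r v).
have cM w : s0 w * val (c w) \in M k by rewrite signM_M //; exact: valP.
have sS : is_sign (sigma [set u; v]%SET) := sigma_pm1 uv.
set sg := sigma _ in sS *.
rewrite mulrA => /eqP.
(* If the edge is positive after switching, injectivity of [f] alone carries a bad edge back to
   [c]. *)
have [su|su] := eqVneq (s0 u) (sg * s0 v).
  rewrite -su => /(can_inj (signMK (s0_sign u))) /finj -/(_ (cM u) (cM v)).
  move=> /(congr1 ( *%R (s0 u))); rewrite signMK // => ->.
  by rewrite su !mulrA -[sg * _ * _]mulrA is_sign_sqr // mulr1.
have {}su : s0 u = - (sg * s0 v) by apply: sign_neq => //; apply: is_signM.
(* The edge is now negative after switching: passing from the root to [u] directly or through [v]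
   gives opposite signs, so the root list is symmetric and [f] is odd. *)
have symL : L (r v) = scale_set (-1) (L (r v)).
  have e1 := L_consistent uv.
  rewrite (s0L u) (s0L v) -/(r u) -/(r v) ruv -/sg in e1.
  rewrite {1}(scale_setK (s0_sign u) (esym e1)) -scale_setM // -scale_setM //.
    by rewrite -[_ * _ * _]mulrA su mulNr is_sign_sqr //; apply: is_signM.
  exact: is_signM.
have -> : sg * s0 v = - s0 u by rewrite su opprK.
rewrite mulNr -mulrN -(fodd symL) => /(can_inj (signMK (s0_sign u))) /finj.
rewrite oppM => /(_ (cM u) (cM v)) /(congr1 ( *%R (s0 u))).
rewrite signMK // => ->.
by rewrite su mulrN mulNr opprK !mulrA -[sg * _ * _]mulrA is_sign_sqr // mulr1.
Qed.

(** Unlike in [connect_scale], the sign is explicit, to be evaluated around a closed walk. *)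
Lemma path_scale u p : path (@adj Sg) u p ->
  is_sign (\prod_(e <- pairmap (fun a b => [set a; b]%SET) u p) sigma e) /\
  L u = scale_set (\prod_(e <- pairmap (fun a b => [set a; b]%SET) u p) sigma e)
          (L (last u p)).
Proof.
elim: p u => [|w p IH] u /=.
  by rewrite big_nil scale_set1; split=> //; left.
move=> /andP[uw /IH [ss Lw]]; have sS := sigma_pm1 uw.
rewrite big_cons; split; first exact: is_signM.
by rewrite scale_setM // -Lw; apply: L_consistent.
Qed.

(** Going once round the cycle scales [L x] by the product of its signs, and the number of negative
    edges is odd. *)
Lemma unbalanced_cycle_symmetric x (q : seq Sg) :
  unbalanced_cycle (x :: q) -> L x = scale_set (-1) (L x).
Proof.
move=> /andP[/andP[sp /andP[cp up]] oddp]; set p := x :: q in sp cp up oddp.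
pose f y := [set y; next p y]%SET.
have [_] := path_scale cp; rewrite last_rcons.
have -> : pairmap (fun a b => [set a; b]%SET) x (rcons q x) = map f p.
  apply: (@eq_from_nth _ set0).
    by rewrite size_pairmap size_map size_rcons.
  move=> i; rewrite size_pairmap size_rcons => iq.
  rewrite (nth_pairmap x) ?size_rcons // (nth_map x) ?size_rcons //.
  rewrite /f next_uniq_nth //.
  rewrite -rcons_cons !nth_rcons /= iq; case: ltnP => // qi.
  have -> : i = size q by apply/eqP; rewrite eqn_leq -ltnS iq.
  by rewrite eqxx [nth x q _]nth_default.
rewrite big_map.
have -> : \prod_(y <- p) sigma (f y) =
    \prod_(y <- p) (if sigma (f y) == -1 then -1 else 1).
  apply: eq_big_seq => y yp; have := next_cycle cp yp.
  by move=> /sigma_pm1; rewrite -/(f y) => -[] ->.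
rewrite -big_mkcond big_const_seq iter_mulr_1.
suff -> : count (fun y => sigma (f y) == -1) p =
    #|[set e in cycle_edges p | sigma e == -1]%SET|.
  by rewrite -signr_odd oddp.
have -> : [set e in cycle_edges p | sigma e == -1]%SET =
    (f @: [set y in [seq y <- p | sigma (f y) == -1]])%SET.
  apply/setP => e; rewrite inE; apply/andP/imsetP.
    move=> [/imsetP [y yp ->] ye]; exists y => //.
    by rewrite inE mem_filter ye.
  move=> [y]; rewrite inE mem_filter => /andP[ye yp] ->; split=> //.
  by apply/imsetP; exists y.
rewrite card_in_imset.
  by rewrite cardsE (card_uniqP _) ?filter_uniq // size_filter.
move=> y z; rewrite !inE !mem_filter => /andP[_ yp] /andP[_ zp].
exact: cycle_edge_inj.
Qed.

(** Symmetry spreads from a vertex of the cycle through the component because scalings by signs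
    commute. *)
Lemma unbalanced_component_symmetric (C : {set Sg}) v :
  unbalanced_component C -> v \in C -> L v = scale_set (-1) (L v).
Proof.
move=> [[w ->] [p [pU pC]]]; rewrite inE => wv.
case: p => [|x q] in pU pC *; first by case/andP: pU.
have := pC x (mem_head x q); rewrite inE => wx.
have xv : connect (@adj Sg) x v.
  by apply: connect_trans wv; rewrite (sym_connect_sym adj_sym).
have [s ss ->] := connect_scale xv.
rewrite -scale_setM //; last by right.
by rewrite mulrC scale_setM -?(unbalanced_cycle_symmetric pU) //; right.
Qed.

End Consistent.

Theorem theorem1p1 (Sg : signed_graph) (k : nat) (k_gt0 : (0 < k)%N)
    (k_bound : ('C(#|edges Sg|, 3))%:Z + ('C(#|edges Sg|, 4))%:Z
                 + #|edges Sg|%:Z - 1 < k%:Z) :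
  [/\ list_coloring_function Sg k = num_colorings Sg k,
      forall L : list_assignment Sg, k_assignment k L ->
        num_list_colorings L = num_colorings Sg k ->
        forall u v : Sg, [set u; v]%SET \in edges Sg ->
          L u = scale_set (sigma [set u; v]%SET) (L v)
    & unbalanced Sg ->
      forall L : list_assignment Sg, k_assignment k L ->
        num_list_colorings L = num_colorings Sg k ->
        forall C : {set Sg}, unbalanced_component C ->
        forall v : Sg, v \in C -> L v = scale_set (-1) (L v)].
Proof.
have Mk : @k_assignment Sg k (fun=> M k) by move=> v; apply: card_M.
have NM : num_colorings Sg k = num_list_colorings (fun _ : Sg => M k) by [].
have bound : ('C(#|edges Sg|, 3) + 'C(#|edges Sg|, 4) + #|edges Sg| <= k)%N.
  by lia.
(* Stated with [<=] to serve both the equality case and an assignment that might undercut [M k]. *)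
have consistent L : k_assignment k L ->
    (num_list_colorings L <= num_colorings Sg k)%N ->
    forall u v : Sg, [set u; v]%SET \in edges Sg ->
      L u = scale_set (sigma [set u; v]%SET) (L v).
  move=> Lk leLM u v uvE; apply: (compat_full Lk uvE); rewrite leqNgt.
  apply/negP => lt_uv; move: leLM; rewrite NM leqNgt.
  have := num_list_colorings_lt Lk Mk k_gt0 (@compat_M Sg k) uvE lt_uv bound.
  by move=> ->.
split.
- rewrite /list_coloring_function.
  case: ex_minnP => j /asboolP [L [Lk <-]] minL.
  apply/eqP; rewrite eqn_leq; apply/andP; split.
    by apply: minL; apply/asboolP; exists (fun=> M k).
  have [leLM|/ltnW//] := leqP (num_list_colorings L) (num_colorings Sg k).
  have cL := consistent L Lk leLM; rewrite NM.
  exact (num_list_colorings_consistent cL Lk k_gt0).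
- by move=> L Lk /eq_leq; apply: consistent.
- move=> _ L Lk eqL C CU v vC.
  have cL := consistent L Lk (eq_leq eqL).
  exact (unbalanced_component_symmetric cL CU vC).
Qed.
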